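(* Let $\beta>0$. Suppose $v\in C^1(X)$ and $w\in C(X)$ satisfy \begin{align*} \nabla v(x)\cdot\bar f(x) &\le \beta v(x) && \forall x\in X_T^c,\\ w(x) &\ge v(x)+1 && \forall x\in X_T^c,\\ w(x) &\ge 0 && \forall x\in X_T^c,\\ v(x) &\ge 0 && \forall x\in X_\partial. \end{align*} Then $\{x\in X: v(x)<0\}\subset X_0$.
   Context: Consider the control system $\dot x(t)=f(x(t))+G(x(t))u(t)$, where $f:\mathbb{R}^n\to\mathbb{R}^n$ and $G:\mathbb{R}^n\to\mathbb{R}^{n\times m}$ have polynomial entries. The state constraint set is $X=\{x\in\mathbb{R}^n: g_X(x)>0\}$ with $g_X$ a polynomial such that $\bar X=\{x\in\mathbb{R}^n: g_X(x)\ge 0\}$ is compact. The input constraint set is $U=[0,\bar u]^m$ with $\bar u\ge 0$. The target set is $X_T=\{x\in\mathbb{R}^n: g_T(x)>0\}\subset X$ with $g_T$ a polynomial. The region of attraction $X_0$ is the set of all $x_0\in\mathbb{R}^n$ for which there exist $\tau\in[0,\infty)$, a measurable $u(\cdot)$ and an absolutely continuous $x(\cdot)$ on $[0,\tau]$ such that $\dot x(t)=f(x(t))+G(x(t))u(t)$ for almost every $t\in[0,\tau]$, $x(t)\in X$ and $u(t)\in U$ for all $t\in[0,\tau]$, $x(0)=x_0$, and $x(\tau)\in X_T$. A polynomial feedback controller $x\mapsto u(x)\in\mathbb{R}^m$ satisfying the input constraints, i.e. $u(x)\in U$ for all $x\in\bar X$, is fixed, and $\bar f(x):=f(x)+G(x)u(x)$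 is the vector field of the closed-loop system $\dot x=\bar f(x)$. Set $X_T^c:=\{x\in\mathbb{R}^n: g_X(x)\ge 0,\ g_T(x)\le 0\}$ and $X_\partial:=\{x\in\mathbb{R}^n: g_X(x)=0\}$. Convention: $v\in C^1(X)$ and $w\in C(X)$ are understood to be defined up to the boundary of the constraint set, i.e. $v$ is (the restriction to $\bar X$ of) a continuously differentiable function on a neighbourhood of $\bar X$ and $w$ is continuous on $\bar X$, so that the inequalities on $X_T^c$ and $X_\partial$ make sense. *)

(* Defs.v *)
From HB Require Import structures.
From mathcomp Require Import all_boot all_order all_algebra.
From mathcomp Require Import all_classical all_reals all_analysis.
(* not imported: the notations of mpoly clash with those of analysis *)
From mathcomp Require mpoly.

Set Implicit Arguments.
Unset Strict Implicit.
Unset Printing Implicit Defensive.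

Import Order.TTheory GRing.Theory Num.Theory.
Import numFieldNormedType.Exports.

Local Open Scope classical_set_scope.
Local Open Scope ring_scope.

Definition pol (R : realType) (n : nat) := mpoly.mpoly n R.

Definition peval (R : realType) (n : nat) (x : 'cV[R]_n) (p : pol R n) : R :=
  mpoly.meval (fun i : 'I_n => x i 0) p.

Definition mxeval (R : realType) (n k l : nat) (A : 'M[pol R n]_(k, l))
    (x : 'cV[R]_n) : 'M[R]_(k, l) :=
  map_mx (peval x) A.

Definition dot (R : realType) (n : nat) (a b : 'cV[R]_n) : R :=
  \sum_(i < n) a i 0 * b i 0.

Definition grad (R : realType) (n : nat) (v : 'cV[R]_n -> R) (x : 'cV[R]_n) :
    'cV[R]_n :=
  \col_i 'D_(delta_mx i 0) v x.

Definition C1_up_to (R : realType) (n : nat) (A : set 'cV[R]_n)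
    (v : 'cV[R]_n -> R) : Prop :=
  exists O : set 'cV[R]_n,
    [/\ open O, A `<=` O &
        forall x, O x -> differentiable v x /\ {for x, continuous (grad v)}].

Definition abs_continuous (R : realType) (n : nat) (a b : R)
    (x : R -> 'cV[R]_n) : Prop :=
  forall e : R, 0 < e -> exists2 d : R, 0 < d &
    forall (k : nat) (s t : 'I_k -> R),
      (forall i, a <= s i /\ s i <= t i /\ t i <= b) ->
      trivIset [set: 'I_k] (fun i => [set` `]s i, t i[]) ->
      \sum_(i < k) (t i - s i) < d ->
      \sum_(i < k) `|x (t i) - x (s i)| < e.

(* The Caratheodory sigma-algebra of the Lebesgue outer measure, that is, the
   Lebesgue-measurable sets; the default structure on R is Borel *)
Definition lebesgueR (R : realType) :=
  caratheodory_type ((@wlength R idfun)^*)%mu.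

Definition lebesgue_measurable_fun (R : realType) (D : set R) (h : R -> R) :
    Prop :=
  measurable_fun (D : set (lebesgueR R)) (h : lebesgueR R -> R).

Section ControlSystem.
Variables (R : realType) (n m : nat).
Implicit Types (g : pol R n) (x : 'cV[R]_n).

Definition pos_set g : set 'cV[R]_n := [set x | 0 < peval x g].

Definition nneg_set g : set 'cV[R]_n := [set x | 0 <= peval x g].

Definition zero_set g : set 'cV[R]_n := [set x | peval x g = 0].

Definition target_compl (gX gT : pol R n) : set 'cV[R]_n :=
  [set x | 0 <= peval x gX /\ peval x gT <= 0].

Definition input_box (ubar : R) : set 'cV[R]_m :=
  [set a | forall j, 0 <= a j 0 <= ubar].

Definition control_field (f : 'cV[pol R n]_n) (G : 'M[pol R n]_(n, m))
    (x : 'cV[R]_n) (a : 'cV[R]_m) : 'cV[R]_n :=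
  mxeval f x + mxeval G x *m a.

Definition closed_loop (f : 'cV[pol R n]_n) (G : 'M[pol R n]_(n, m))
    (u : 'cV[pol R n]_m) (x : 'cV[R]_n) : 'cV[R]_n :=
  control_field f G x (mxeval u x).

(* The signals u and x are total functions of time, of which only the values
   on [0, tau] are constrained. *)
Definition region_of_attraction (f : 'cV[pol R n]_n) (G : 'M[pol R n]_(n, m))
    (X : set 'cV[R]_n) (U : set 'cV[R]_m) (XT : set 'cV[R]_n) :
    set 'cV[R]_n :=
  [set x0 | exists (tau : R) (u : R -> 'cV[R]_m) (x : R -> 'cV[R]_n),
    0 <= tau /\
    (forall j, lebesgue_measurable_fun `[0, tau] (fun t => u t j 0)) /\
    abs_continuous 0 tau x /\
    {ae (@lebesgue_measure R), forall t : R, 0 <= t <= tau ->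
       is_derive t (1 : R) x (control_field f G (x t) (u t))} /\
    (forall t : R, 0 <= t <= tau -> X (x t) /\ U (u t)) /\
    x 0 = x0 /\
    XT (x tau)].

End ControlSystem.

(* Main.v *)
(* Xbar is compact, so the closed-loop field, precomposed with the clamping of
   the coordinates to a box containing Xbar, is bounded and globally Lipschitz;
   Picard iteration gives a solution x on [0, +oo[ that follows the closed loop
   as long as it stays in Xbar. If x0 were not in the region of attraction,
   x would satisfy g_T <= 0 as long as it stays in X, hence
   v(x(t)) <= expR(beta t) v(x0) < 0 by the flow inequality. As v >= 0 on the
   boundary, x could never leave X, and v(x(t)) would tend to -oo, although v
   is bounded on Xbar. *)
Require Import Defs.
From HB Require Import structures.
From mathcomp Require Import all_boot all_order all_algebra.
From mathcomp Require Import all_classical all_reals all_analysis.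
From mathcomp Require mpoly.
From mathcomp Require Import ring lra.

Set Implicit Arguments.
Unset Strict Implicit.
Unset Printing Implicit Defensive.

Import Order.TTheory GRing.Theory Num.Theory.
Import numFieldNormedType.Exports.

Local Open Scope classical_set_scope.
Local Open Scope ring_scope.

(** * Sup norm of column vectors and geometric convergence *)

Lemma coord_normr_le (R : realType) (n : nat) (x : 'cV[R]_n) i :
  `|x i 0| <= `|x|.
Proof.
rewrite [leRHS]/Num.Def.normr/= mx_normrE.
exact: (le_bigmax _ (fun ij : 'I_n * 'I_1 => `|x ij.1 ij.2|) (i, 0)).
Qed.

Lemma cV_normr_le (R : realType) (n : nat) (x : 'cV[R]_n) (c : R) :
  0 <= c -> (forall i, `|x i 0| <= c) -> `|x| <= c.
Proof.
move=> c0 xc; rewrite [leLHS]/Num.Def.normr/= mx_normrE.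
by apply: bigmax_le => // -[i j] _ /=; rewrite ord1.
Qed.

(** The error term tends to 0. Estimates that hold up to the error of the [k]-th Picard iterate pass
    to the limit in this way. *)
Lemma le_geometric_half (R : realType) (a b c : R) :
  (forall k, a <= b + c * 2^-1 ^+ k) -> a <= b.
Proof.
move=> ac; have c0 : c * 2^-1 ^+ k @[k --> \oo] --> (0 : R).
  by apply: (@cvg_geometric R c 2^-1); rewrite ger0_norm; lra.
rewrite -subr_le0 -(cvg_lim _ c0)//; apply: limr_ge.
  by apply/cvg_ex; exists 0.
by apply: nearW => k; rewrite lerBlDl.
Qed.

(** By telescoping, the intervals of radius [2 * c * 2^-1 ^+ k] around [u k] meet pairwise; the
    supremum of their left ends therefore lies in all of them. *)
Lemma geometric_increments_lim (R : realType) (u : nat -> R) (c : R) :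
  (forall k, `|u k.+1 - u k| <= c * 2^-1 ^+ k) ->
  exists l, forall k, `|l - u k| <= 2 * c * 2^-1 ^+ k.
Proof.
move=> uc; have c0 : 0 <= c.
  by have := uc 0%N; rewrite expr0 mulr1; exact: le_trans.
have pow0 k : 0 <= c * 2^-1 ^+ k by rewrite mulr_ge0// exprn_ge0.
have dist k m : (k <= m)%N -> `|u m - u k| <= 2 * c * 2^-1 ^+ k.
  move=> /subnKC <-; set j := (m - k)%N.
  (* Keeping the subtracted tail makes the bound additive in [j], so that the induction closes. *)
  have : `|u (k + j)%N - u k| <= 2 * c * (2^-1 ^+ k - 2^-1 ^+ (k + j)).
    elim: j => [|j ih]; first by rewrite addn0 !subrr normr0 mulr0.
    rewrite addnS (le_trans (ler_distD (u (k + j)%N) _ _))//.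
    have := lerD (uc (k + j)%N) ih; move/le_trans; apply.
    by rewrite exprS; lra.
  by move=> /le_trans; apply; have := pow0 (k + j)%N; lra.
pose a k := u k - 2 * c * 2^-1 ^+ k.
have ab j k : a j <= u k + 2 * c * 2^-1 ^+ k.
  rewrite /a; have [jk|/ltnW kj] := leqP j k.
    by have := dist _ _ jk; have := pow0 k; rewrite ler_norml => ? /andP[]; lra.
  by have := dist _ _ kj; have := pow0 j; rewrite ler_norml => ? /andP[]; lra.
have a0 : range a !=set0 by exists (a 0%N); exists 0%N.
have abd k : ubound (range a) (u k + 2 * c * 2^-1 ^+ k) by move=> _ [j _ <-].
exists (sup (range a)) => k; rewrite ler_distl; apply/andP; split.
  by apply: ub_le_sup; [exists (u 0%N + 2 * c * 2^-1 ^+ 0)| exists k].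
exact: ge_sup.
Qed.

(** * Comparison of increments through derivatives *)

(** The difference [g - f] is nondecreasing. Derivatives are compared on the open interval only,
    since the flow inequality will be integrated up to a time at which the trajectory may lie on the
    boundary. *)
Lemma is_derive_le_increment (R : realType) (f g df dg : R -> R) (a b : R) :
  a <= b ->
  (forall t, a <= t <= b -> is_derive t 1 f (df t)) ->
  (forall t, a <= t <= b -> is_derive t 1 g (dg t)) ->
  (forall t, a < t < b -> df t <= dg t) ->
  f b - f a <= g b - g a.
Proof.
move=> ab fE gE fg.
have hE t : a <= t <= b -> is_derive t 1 (g - f) (dg t - df t).
  by move=> tab; have := fE _ tab; have := gE _ tab => ? ?; exact: is_deriveB.
suff : (g - f) a <= (g - f) b by rewrite !fctE; lra.
have sub t : t \in `]a, b[ -> a <= t <= b.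
  by rewrite in_itv/= => /andP[/ltW -> /ltW ->].
apply: (@ger0_derive1_le_cc _ (g - f) a b).
- by move=> t /sub/hE[].
- move=> t tab; rewrite derive1E; have [_ ->] := hE _ (sub _ tab).
  by rewrite subr_ge0 fg//; move: tab; rewrite in_itv.
- apply: derivable_within_continuous => t; rewrite in_itv => tab.
  by have [] := hE _ tab.
- by rewrite in_itv/= lexx.
- by rewrite in_itv/= ab lexx.
- by [].
Qed.

Lemma is_derive_cV (R : realType) (n : nat) (x : R -> 'cV[R]_n) (t : R) dx :
  is_derive t 1 x dx <-> forall i, is_derive t 1 (fun s => x s i 0) (dx i 0).
Proof.
split=> [[xt <-] i|xt].
  rewrite derive_mx// mxE; apply: DeriveDef => //.
  by move/derivable_mxP : xt; exact.
have dt : derivable x t 1.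
  by apply/derivable_mxP => i j; rewrite ord1; have [] := xt i.
apply: DeriveDef => //; rewrite derive_mx//; apply/matrixP => i j.
by rewrite mxE ord1; have [_ ->] := xt i.
Qed.

(** Mean value inequality in the sup norm: each coordinate and its opposite are compared with
    [h]. *)
Lemma cV_increment_le (R : realType) (n : nat) (x : R -> 'cV[R]_n)
    (dx : R -> 'cV[R]_n) (h dh : R -> R) (a b : R) :
  a <= b ->
  (forall t, a <= t <= b -> is_derive t 1 x (dx t)) ->
  (forall t, a <= t <= b -> is_derive t 1 h (dh t)) ->
  (forall t, a <= t <= b -> `|dx t| <= dh t) ->
  `|x b - x a| <= h b - h a.
Proof.
move=> ab xE hE le.
have le' i t : a < t < b -> `|dx t i 0| <= dh t.
  move=> /andP[/ltW at_ /ltW tb].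
  by apply: le_trans (coord_normr_le _ _) (le _ _); rewrite at_.
have xiE i t : a <= t <= b -> is_derive t 1 (fun s => x s i 0) (dx t i 0).
  by move=> /xE/is_derive_cV.
have dh0 t : a < t < b -> 0 <= dh t.
  move=> /andP[/ltW at_ /ltW tb].
  by apply: le_trans (le t _); rewrite ?at_.
apply: cV_normr_le => [|i].
  (* [cV_normr_le] asks for a nonnegative bound, which no coordinate supplies when [n = 0];
     comparing [h] with the zero function gives it. *)
  have := @is_derive_le_increment R (fun=> 0) h (fun=> 0) dh a b ab.
  rewrite subrr => H; apply: H => // t _; exact: is_derive_cst.
rewrite !mxE ler_norml; apply/andP; split.
  have NE t : a <= t <= b -> is_derive t 1 (fun s => - x s i 0) (- dx t i 0).
    by move=> /(xiE i)[? <-]; apply: DeriveDef;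
      [exact: derivableN|exact: deriveN].
  have le'N t : a < t < b -> - dx t i 0 <= dh t.
    by move=> /(le' i); rewrite ler_norml => /andP[]; lra.
  by have := is_derive_le_increment ab NE hE le'N; lra.
apply: (is_derive_le_increment ab (xiE i) hE) => t tab.
by have := le' i t tab; rewrite ler_norml => /andP[].
Qed.

(** * Primitives, Lipschitz continuity and exponential growth *)

Lemma continuous_primitive (R : realType) (g : R -> R) :
  continuous g ->
  exists G : R -> R, forall t : R, 0 <= t -> is_derive t 1 G (g t).
Proof.
move=> cg.
(* Integrating from -1 makes 0 an interior point, where FTC applies. *)
exists (fun t => \int[@lebesgue_measure R]_(s in `[-1, t]) g s)%R => t t0.
have tt1 : t < t + 1 by rewrite ltrDl.
have gi : (@lebesgue_measure R).-integrable
    [set` Interval (BLeft (-1)) (BRight (t + 1))] (EFin \o g).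
  apply: continuous_compact_integrable; first exact: segment_compact.
  exact: continuous_subspaceT.
have [|dG GE] := @continuous_FTC1 R g (BLeft (-1)) t (t + 1) tt1 gi _ (cg t).
  by rewrite lte_fin; lra.
by apply: DeriveDef => //; rewrite -derive1E.
Qed.

Lemma continuous_primitive_cV (R : realType) (n : nat) (g : R -> 'cV[R]_n)
    (x0 : 'cV[R]_n) :
  continuous g ->
  exists2 x : R -> 'cV[R]_n,
    x 0 = x0 & forall t : R, 0 <= t -> is_derive t 1 x (g t).
Proof.
move=> cg.
have [G GE] : {G : 'I_n -> R -> R &
    forall i (t : R), 0 <= t -> is_derive t 1 (G i) (g t i 0)}.
  apply: (@choice _ _ (fun i G =>
    forall t : R, 0 <= t -> is_derive t 1 G (g t i 0))) => i.
  apply: continuous_primitive => t.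
  by apply: (@continuous_comp _ _ _ g (fun M : 'cV[R]_n => M i 0));
    [exact: cg|exact: coord_continuous].
exists (fun t => x0 + (\col_i (G i t - G i 0))).
  by apply/matrixP => i j; rewrite !mxE subrr addr0 ord1.
move=> t t0; apply/is_derive_cV => i.
have Ei : is_derive t 1 (G i) (g t i 0) by exact: GE.
rewrite (_ : (fun s => _) = (cst (x0 i 0) + (G i - cst (G i 0)))); last first.
  by apply/funext => s; rewrite !mxE.
by apply: is_derive_eq; rewrite subr0 add0r.
Qed.

Lemma lipschitz_continuous (R : realType) (V W : normedModType R) (f : V -> W)
    (K : R) :
  0 < K -> (forall x y, `|f x - f y| <= K * `|x - y|) -> continuous f.
Proof.
move=> K0 fK x; apply/cvgrPdist_lt => e e0; apply/nbhs_ballP.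
exists (K^-1 * e) => /=; first by rewrite mulr_gt0// invr_gt0.
move=> y; rewrite -ball_normE /= => xy.
by rewrite (le_lt_trans (fK _ _))// -ltr_pdivlMl.
Qed.

Lemma is_derive_mulrl (R : realType) (c t : R) : is_derive t 1 ( *%R c) c.
Proof.
have := is_deriveZ c (is_derive_id t (1 : R)).
by rewrite /GRing.scale/= mulr1.
Qed.

Lemma is_derive_expRM (R : realType) (K t : R) :
  is_derive t 1 (fun s : R => expR (K * s)) (K * expR (K * t)).
Proof.
have := is_derive1_comp (is_derive_expR (K * t)) (is_derive_mulrl K t).
by rewrite mulrC.
Qed.

(** Integration of the bound on [dx] from 0, where the term [- c / K] is dropped. The gain of a
    factor [1 / K] is what makes the Picard step contract. *)
Lemma expR_growth_bound (R : realType) (n : nat) (x dx : R -> 'cV[R]_n)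
    (c K : R) :
  0 < K -> 0 <= c -> x 0 = 0 ->
  (forall t : R, 0 <= t -> is_derive t 1 x (dx t)) ->
  (forall t : R, 0 <= t -> `|dx t| <= c * expR (K * t)) ->
  forall t : R, 0 <= t -> `|x t| <= c / K * expR (K * t).
Proof.
move=> K0 c0 x0 xE dxc t t0.
have hE (s : R) : is_derive s 1 (fun r : R => c / K * expR (K * r))
    (c * expR (K * s)).
  have := is_deriveZ (c / K) (is_derive_expRM K s).
  by rewrite /GRing.scale/= mulrA divfK// gt_eqF.
have ge0 (s : R) : 0 <= s <= t -> 0 <= s by case/andP.
have := cV_increment_le t0 (fun s st => xE s (ge0 s st)) (fun s _ => hE s)
  (fun s st => dxc s (ge0 s st)).
rewrite x0 subr0 => /le_trans; apply.
by rewrite gerBl mulr_ge0 ?expR_ge0// divr_ge0// ltW.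
Qed.

(** * Global solutions of Lipschitz equations by Picard iteration *)

Section GlobalSolution.
Variables (R : realType) (n : nat) (F : 'cV[R]_n -> 'cV[R]_n) (L M : R).
Hypotheses (L_gt0 : 0 < L) (F_bounded : forall x, `|F x| <= M).
Hypothesis F_lipschitz : forall x y, `|F x - F y| <= L * `|x - y|.

(* The iterates matter for t >= 0 only; clamping the time at 0 gives them
   two-sided derivatives at 0 as well. *)
Lemma picard_step (x0 : 'cV[R]_n) (y : R -> 'cV[R]_n) :
  continuous (fun t : R => y (Num.max t 0)) ->
  exists2 x : R -> 'cV[R]_n,
    x 0 = x0 & forall t : R, 0 <= t -> is_derive t 1 x (F (y t)).
Proof.
move=> cy.
have cg : continuous (fun t : R => F (y (Num.max t 0))).
  move=> t; apply: (@continuous_comp _ _ _ (fun t : R => y (Num.max t 0)) F).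
    exact: cy.
  exact: (lipschitz_continuous L_gt0 F_lipschitz).
have [x x0E xE] := continuous_primitive_cV x0 cg.
by exists x => // t t0; have := xE t t0; rewrite max_l.
Qed.

(** The Picard iterates converge geometrically at each [t >= 0]. Their limit is continuous there,
    and one more Picard step leaves it unchanged, so the result of that step solves the equation. *)
Lemma lipschitz_ode_solution (x0 : 'cV[R]_n) :
  exists2 x : R -> 'cV[R]_n,
    x 0 = x0 & forall t : R, 0 <= t -> is_derive t 1 x (F (x t)).
Proof.
have M0 : 0 <= M by apply: le_trans (F_bounded x0).
pose cont (y : R -> 'cV[R]_n) := continuous (fun t : R => y (Num.max t 0)).
have pos_ge0 (t : R) : 0 <= Num.max t 0 by rewrite le_max lexx orbT.
have [T TP] : {T : (R -> 'cV[R]_n) -> (R -> 'cV[R]_n) & forall y, cont y ->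
    T y 0 = x0 /\ forall t : R, 0 <= t -> is_derive t 1 (T y) (F (y t))}.
  apply: (@choice _ _ (fun y x => cont y -> x 0 = x0 /\
    forall t : R, 0 <= t -> is_derive t 1 x (F (y t)))) => y.
  (* The operator [T] must be total; where continuity fails, [y] itself is a default value. *)
  have [/(picard_step x0)[x x0E xE]|] := pselect (cont y); last by exists y.
  by exists x.
pose u k := iter k T (cst x0).
have cu k : cont (u k).
  elim: k => [|k /TP[_ ukE]]; first by move=> t; exact: cvg_cst.
  move=> t; apply: (@continuous_comp _ _ _ (fun t : R => Num.max t 0) (u k.+1)).
    by apply: (@continuous_max _ _ id (cst 0)); [exact: cvg_id|exact: cvg_cst].
  have [+ _] := ukE _ (pos_ge0 t).
  by move=> /derivable1_diffP; exact: differentiable_continuous.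
have u0 k : u k 0 = x0 by case: k => [|k] //; have [] := TP _ (cu k).
have uE k (t : R) : 0 <= t -> is_derive t 1 (u k.+1) (F (u k t)).
  by have [_] := TP _ (cu k); exact.
(* Size of the first increment: its speed is at most [M], hence at most [M * expR (2 * L * t)],
   whose integration yields the factor [1 / (2 * L)]. *)
pose C := M / (2 * L).
have L2 : 0 < 2 * L by rewrite mulr_gt0.
(* The weight expR (2 L t) makes the Picard step a contraction of ratio 1/2 on
   the whole half-line. *)
have inc k (t : R) : 0 <= t ->
    `|u k.+1 t - u k t| <= C * expR (2 * L * t) * 2^-1 ^+ k.
  elim: k t => [|k ih] t t0.
    have := @expR_growth_bound R n (fun t => u 1%N t - u 0%N t)
      (fun t => F (u 0%N t)) M (2 * L).
    rewrite expr0 mulr1; apply => //.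
    - by rewrite !u0 subrr.
    - move=> s s0; have := uE 0%N s s0 => ?.
      have ? : is_derive s 1 (u 0%N) 0 by exact: is_derive_cst.
      rewrite -[F _]subr0; exact: is_deriveB.
    - move=> s s0; apply: le_trans (F_bounded _) _; rewrite ler_peMr//.
      by rewrite (le_trans _ (expR_ge1Dx _))// lerDl mulr_ge0// ltW.
  have := @expR_growth_bound R n (fun t => u k.+2 t - u k.+1 t)
    (fun t => F (u k.+1 t) - F (u k t)) (M * 2^-1 ^+ k.+1) (2 * L).
  have -> : C * expR (2 * L * t) * 2^-1 ^+ k.+1 =
      M * 2^-1 ^+ k.+1 / (2 * L) * expR (2 * L * t).
    by rewrite /C; ring.
  apply => //.
  - by rewrite mulr_ge0// exprn_ge0.
  - by rewrite !u0 subrr.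
  - move=> s s0; have := uE k s s0; have := uE k.+1 s s0 => ? ?.
    exact: is_deriveB.
  - move=> s s0; apply: le_trans (F_lipschitz _ _) _.
    have := ih s s0; rewrite -(ler_pM2l L_gt0) => /le_trans; apply.
    rewrite le_eqVlt; apply/orP; left; apply/eqP.
    by rewrite /C exprS; field; rewrite gt_eqF.
(* The pointwise limit of the iterates, built coordinate by coordinate; it is constant for
   [t <= 0]. *)
have [x xP] : {x : R -> 'cV[R]_n & forall t : R, forall k,
    `|x t - u k (Num.max t 0)| <=
    2 * C * expR (2 * L * Num.max t 0) * 2^-1 ^+ k}.
  apply: (@choice _ _ (fun (t : R) x => forall k, `|x - u k (Num.max t 0)| <=
    2 * C * expR (2 * L * Num.max t 0) * 2^-1 ^+ k)) => t.
  have [l lP] : {l : 'I_n -> R & forall i k,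
      `|l i - u k (Num.max t 0) i 0| <=
      2 * (C * expR (2 * L * Num.max t 0)) * 2^-1 ^+ k}.
    apply: (@choice _ _ (fun i l => forall k, `|l - u k (Num.max t 0) i 0| <=
      2 * (C * expR (2 * L * Num.max t 0)) * 2^-1 ^+ k)) => i.
    apply: geometric_increments_lim => k; apply: le_trans (inc k _ (pos_ge0 t)).
    have := coord_normr_le (u k.+1 (Num.max t 0) - u k (Num.max t 0)) i.
    by rewrite !mxE.
  exists (\col_i l i) => k; apply: cV_normr_le => [|i]; last first.
    by rewrite !mxE -(mulrA 2 C); exact: lP.
  by rewrite !mulr_ge0 ?expR_ge0// ?exprn_ge0// ?invr_ge0// ltW.
have ulip k (s t : R) : 0 <= s -> s <= t ->
    `|u k.+1 t - u k.+1 s| <= M * (t - s).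
  move=> s0 st; rewrite mulrBr.
  apply: (@cV_increment_le R n (u k.+1) (fun t => F (u k t)) ( *%R M)
    (cst M)) => //.
  - by move=> r /andP[sr _]; apply: uE; exact: le_trans sr.
  - by move=> r _; exact: is_derive_mulrl.
(* The Lipschitz bound common to all iterates passes to the limit, so continuity of [x] follows from
   pointwise convergence alone. *)
have xlip0 (s t : R) : s <= t ->
    `|x t - x s| <= M * (Num.max t 0 - Num.max s 0).
  move=> st.
  pose b (r : R) := 2 * C * expR (2 * L * Num.max r 0).
  apply: (@le_geometric_half R _ _ (b t / 2 + b s / 2)) => k.
  have mst : Num.max s 0 <= Num.max t 0.
    by rewrite ge_max le_max st/= le_max lexx orbT.
  have xt := xP t k.+1; have xs := xP s k.+1.
  have u_st := ulip k _ _ (pos_ge0 s) mst.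
  rewrite (le_trans (ler_distD (u k.+1 (Num.max t 0)) _ _))//.
  have := ler_distD (u k.+1 (Num.max s 0)) (u k.+1 (Num.max t 0)) (x s).
  rewrite (distrC (u k.+1 (Num.max s 0)) (x s)).
  by move: xt xs; rewrite /b exprS; lra.
have cx : cont x.
  (* [M] may be 0, while [lipschitz_continuous] asks for a positive constant; hence [M + 1]. *)
  have xlip (s t : R) :
      `|x (Num.max t 0) - x (Num.max s 0)| <= (M + 1) * `|t - s|.
    wlog st : s t / s <= t => [H|].
      have [|/ltW] := leP s t; first exact: H.
      by rewrite distrC (distrC t); exact: H.
    have maxst : Num.max s 0 <= Num.max t 0.
      by rewrite ge_max le_max st/= le_max lexx orbT.
    apply: le_trans (xlip0 _ _ maxst) _.
    rewrite (max_l (pos_ge0 t)) (max_l (pos_ge0 s)).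
    rewrite ger0_norm ?subr_ge0//.
    have : 0 <= Num.max t 0 - Num.max s 0 <= t - s.
      by case: (leP t 0); case: (leP s 0); lra.
    by move=> /andP[]; nra.
  apply: (@lipschitz_continuous _ _ _ _ (M + 1)) => //; lra.
have [y y0 yE] := picard_step x0 cx.
have xP' k (s : R) : 0 <= s ->
    `|x s - u k s| <= 2 * C * expR (2 * L * s) * 2^-1 ^+ k.
  by move=> s0; have := xP s k; rewrite max_l.
(* The solution is [y] rather than [x]: being constant for negative times, [x] need not have a
   two-sided derivative at 0. *)
exists y => // t t0; suff <- : x t = y t by exact: yE.
apply/eqP; rewrite -subr_eq0 -normr_le0.
apply: (@le_geometric_half _ _ _ (2 * C * expR (2 * L * t))) => k.
(* A Picard step halves the distance of [x] to [u k]. With the distance of [x] to [u k.+1], the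
   total is [2 * C * expR (2 * L * t) * 2^-1 ^+ k], which tends to 0. *)
have yu : `|y t - u k.+1 t| <= M * 2^-1 ^+ k / (2 * L) * expR (2 * L * t).
  apply: (@expR_growth_bound R n (fun t => y t - u k.+1 t)
    (fun t => F (x t) - F (u k t))) => //.
  - by rewrite mulr_ge0// exprn_ge0.
  - by rewrite y0 u0 subrr.
  - move=> s s0; have := yE s s0; have := uE k s s0 => ? ?.
    exact: is_deriveB.
  - move=> s s0; apply: le_trans (F_lipschitz _ _) _.
    have := xP' k s s0; rewrite -(ler_pM2l L_gt0) => /le_trans; apply.
    rewrite le_eqVlt; apply/orP; left; apply/eqP.
    by rewrite /C; field; rewrite gt_eqF.
rewrite (le_trans (ler_distD (u k.+1 t) _ _))// (distrC _ (y t)).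
have := lerD (xP' k.+1 t t0) yu; move=> /le_trans; apply.
rewrite add0r le_eqVlt; apply/orP; left; apply/eqP.
by rewrite /C exprS; field; rewrite gt_eqF.
Qed.

End GlobalSolution.

(** * Polynomial functions *)

(** An inductive description on the level of functions, so that continuity and Lipschitz bounds are
    proved by induction on sums and products. *)
Inductive polynomial_fun (R : realType) (n : nat) : ('cV[R]_n -> R) -> Prop :=
| polynomial_cst c : polynomial_fun (fun=> c)
| polynomial_coord i : polynomial_fun (fun x => x i 0)
| polynomial_add g h : polynomial_fun g -> polynomial_fun h ->
    polynomial_fun (fun x => g x + h x)
| polynomial_mul g h : polynomial_fun g -> polynomial_fun h ->
    polynomial_fun (fun x => g x * h x).

Lemma polynomial_sum (R : realType) (n : nat) (I : Type) (s : seq I)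
    (h : I -> 'cV[R]_n -> R) :
  (forall i, polynomial_fun (h i)) ->
  polynomial_fun (fun x => \sum_(i <- s) h i x).
Proof.
move=> ph; elim: s => [|i s ps].
  under eq_fun do rewrite big_nil; exact: polynomial_cst.
by under eq_fun do rewrite big_cons; exact: polynomial_add.
Qed.

Lemma polynomial_prod (R : realType) (n : nat) (I : Type) (s : seq I)
    (h : I -> 'cV[R]_n -> R) :
  (forall i, polynomial_fun (h i)) ->
  polynomial_fun (fun x => \prod_(i <- s) h i x).
Proof.
move=> ph; elim: s => [|i s ps].
  under eq_fun do rewrite big_nil; exact: polynomial_cst.
by under eq_fun do rewrite big_cons; exact: polynomial_mul.
Qed.

Lemma polynomial_peval (R : realType) (n : nat) (p : pol R n) :
  polynomial_fun (fun x => peval x p).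
Proof.
under eq_fun do rewrite /peval mpoly.mevalE.
apply: polynomial_sum => a; apply: polynomial_mul.
  exact: polynomial_cst.
apply: polynomial_prod => i.
elim: (mpoly.fun_of_multinom a i) => [|k ih].
  by under eq_fun do rewrite expr0; exact: polynomial_cst.
under eq_fun do rewrite exprS.
by apply: polynomial_mul => //; exact: polynomial_coord.
Qed.

Lemma polynomial_closed_loop (R : realType) (n m : nat) (f : 'cV[pol R n]_n)
    (G : 'M[pol R n]_(n, m)) (u : 'cV[pol R n]_m) i :
  polynomial_fun (fun x => closed_loop f G u x i 0).
Proof.
under eq_fun do rewrite !mxE.
apply: polynomial_add; first exact: polynomial_peval.
apply: polynomial_sum => j; under eq_fun do rewrite !mxE.
by apply: polynomial_mul; exact: polynomial_peval.
Qed.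

Lemma polynomial_continuous (R : realType) (n : nat) (h : 'cV[R]_n -> R) :
  polynomial_fun h -> continuous h.
Proof.
elim=> {h} [c|i|g h _ cg _ ch|g h _ cg _ ch] x.
- exact: cst_continuous.
- exact: coord_continuous.
- exact: (continuousD (cg x) (ch x)).
- exact: (continuousM (cg x) (ch x)).
Qed.

(** * Clamping to a box and global Lipschitz bounds *)

Lemma clampr_norm_le (R : realType) (r a : R) :
  0 <= r -> `|Num.max (- r) (Num.min r a)| <= r.
Proof.
move=> r0; rewrite ler_norml le_max lexx/= ge_max ge_min lexx/= andbT.
by lra.
Qed.

Lemma clampr_lipschitz (R : realType) (r a b : R) :
  `|Num.max (- r) (Num.min r a) - Num.max (- r) (Num.min r b)| <= `|a - b|.
Proof.
have maxL (c d e : R) : `|Num.max c d - Num.max c e| <= `|d - e|.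
  rewrite ler_norml; case: (ler0P (d - e)); case: (leP c d); case: (leP c e);
    by move=> *; apply/andP; split; lra.
have minL (c d e : R) : `|Num.min c d - Num.min c e| <= `|d - e|.
  rewrite ler_norml; case: (ler0P (d - e)); case: (leP c d); case: (leP c e);
    by move=> *; apply/andP; split; lra.
exact: le_trans (maxL _ _ _) (minL _ _ _).
Qed.

(** For [0 <= r], a 1-Lipschitz retraction onto the closed sup-norm ball of radius [r].
    Precomposition with it makes a polynomial, in general only locally Lipschitz, bounded and
    globally Lipschitz. *)
Definition clamp (R : realType) (n : nat) (r : R) (x : 'cV[R]_n) : 'cV[R]_n :=
  \col_i Num.max (- r) (Num.min r (x i 0)).

Lemma clamp_id (R : realType) (n : nat) (r : R) (x : 'cV[R]_n) :
  `|x| <= r -> clamp r x = x.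
Proof.
move=> xr; apply/matrixP => i j; rewrite !mxE ord1.
have := le_trans (coord_normr_le x i) xr.
rewrite ler_norml => /andP[? ?].
by rewrite min_r// max_r.
Qed.

Definition bounded_lipschitz (R : realType) (V W : normedModType R)
    (h : V -> W) (K : R) :=
  forall x y, `|h x| <= K /\ `|h x - h y| <= K * `|x - y|.

Lemma polynomial_clamp_bounded_lipschitz (R : realType) (n : nat) (r : R)
    (h : 'cV[R]_n -> R) :
  0 <= r -> polynomial_fun h ->
  exists K, bounded_lipschitz (fun x => h (clamp r x)) K.
Proof.
move=> r0.
elim=> {h}.
- move=> c; exists `|c| => x y; split => //.
  by rewrite subrr normr0 mulr_ge0.
- move=> i; exists (r + 1) => x y; rewrite !mxE; split.
    by apply: le_trans (clampr_norm_le _ r0) _; rewrite lerDl.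
  apply: le_trans (clampr_lipschitz _ _ _) _.
  have := coord_normr_le (x - y) i; rewrite !mxE => /le_trans; apply.
  by rewrite ler_peMl// lerDr.
- move=> g h _ [K gK] _ [K' hK]; exists (K + K') => x y.
  have [? ?] := gK x y; have [? ?] := hK x y; split.
    by apply: le_trans (ler_normD _ _) _; lra.
  rewrite opprD addrACA (le_trans (ler_normD _ _))//; lra.
(* The Lipschitz estimate of the product uses [2 * K * K'] and its bound uses [K * K']; the sum
   serves for both. *)
- move=> g h _ [K gK] _ [K' hK]; exists (2 * K * K' + K * K') => x y.
  have [gx gxy] := gK x y; have [hx hxy] := hK x y.
  have [hy _] := hK y x.
  have K0 : 0 <= K by apply: le_trans gx.
  have K'0 : 0 <= K' by apply: le_trans hx.
  have KK := mulr_ge0 K0 K'0.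
  split; first by rewrite normrM (le_trans (ler_pM _ _ gx hx))//; lra.
  rewrite (_ : _ - _ = g (clamp r x) * (h (clamp r x) - h (clamp r y)) +
    (g (clamp r x) - g (clamp r y)) * h (clamp r y)); last by ring.
  rewrite (le_trans (ler_normD _ _))// !normrM.
  have := mulr_ge0 KK (normr_ge0 (x - y)).
  have := ler_pM (normr_ge0 _) (normr_ge0 _) gx hxy.
  have := ler_pM (normr_ge0 _) (normr_ge0 _) gxy hy.
  by lra.
Qed.

Lemma clamp_polynomial_bounded_lipschitz (R : realType) (n k : nat) (r : R)
    (F : 'cV[R]_n -> 'cV[R]_k) :
  0 <= r -> (forall i, polynomial_fun (fun x => F x i 0)) ->
  exists K, bounded_lipschitz (F \o clamp r) K.
Proof.
move=> r0 Fp; have [K KP] : {K : 'I_k -> R &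
    forall i, bounded_lipschitz (fun x => F (clamp r x) i 0) (K i)}.
  apply: (@choice _ _ (fun i K =>
    bounded_lipschitz (fun x => F (clamp r x) i 0) K)) => i.
  exact: (polynomial_clamp_bounded_lipschitz r0 (Fp i)).
have K0 i : 0 <= K i by have [+ _] := KP i 0 0; exact: le_trans.
(* The sum of the constants replaces their maximum, and still makes sense without coordinates. *)
have KS i : K i <= \sum_j K j.
  by rewrite (bigD1 i)//= lerDl sumr_ge0.
have S0 : 0 <= \sum_j K j by rewrite sumr_ge0.
exists (\sum_j K j) => x y; split; apply: cV_normr_le => [|i] //.
- by have [+ _] := KP i x y; move/le_trans; apply.
- by rewrite mulr_ge0.
- rewrite !mxE; have [_] := KP i x y; move/le_trans; apply.
  by rewrite ler_wpM2r.
Qed.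

(** * Chain rule, regularity of trajectories and first zeros *)

Lemma is_derive_along (R : realType) (n : nat) (v : 'cV[R]_n -> R)
    (x : R -> 'cV[R]_n) (t : R) (dx : 'cV[R]_n) :
  differentiable v (x t) -> is_derive t 1 x dx ->
  is_derive t 1 (v \o x) (dot (grad v (x t)) dx).
Proof.
move=> dv [/derivable1_diffP xt <-].
have dvx : differentiable (v \o x) t by exact: differentiable_comp.
apply: DeriveDef; first exact/derivable1_diffP.
rewrite [in LHS]deriveE// diff_comp//= (deriveE _ xt); move: ('d x t 1) => dx'.
(* Expanding the velocity in the standard basis turns the differential of [v] into the scalar
   product with the gradient. *)
rewrite [in LHS](matrix_sum_delta dx') linear_sum; apply: eq_bigr => i _.
by rewrite big_ord1 linearZ/= mxE deriveE// mulrC.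
Qed.

(** Borel sets are Caratheodory measurable. The function [g] is a continuous substitute for [h],
    whose values at negative times are not controlled. *)
Lemma continuous_lebesgue_measurable (R : realType) (g h : R -> R) (tau : R) :
  continuous g -> (forall t, 0 <= t -> g t = h t) ->
  lebesgue_measurable_fun `[0, tau] h.
Proof.
move=> cg gh _ Y mY.
have mg : measurable_fun (`[0, tau] : set R) g.
  apply: measurable_funTS.
  exact: measurable_realfun.continuous_measurable_fun.
rewrite (_ : _ `&` _ = `[0, tau] `&` g @^-1` Y); last first.
  by apply/seteqP; split => t /= []; rewrite in_itv/= => /[dup] /andP[t0 _] ? ?;
    split=> //; move: (gh t t0) => ghE; rewrite ?ghE// -?ghE.
apply: sub_caratheodory; exact: mg.
Qed.

Lemma lipschitz_abs_continuous (R : realType) (n : nat) (x : R -> 'cV[R]_n)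
    (K a b : R) :
  0 < K ->
  (forall s t, a <= s -> s <= t -> `|x t - x s| <= K * (t - s)) ->
  abs_continuous a b x.
Proof.
move=> K0 xK e e0; exists (K^-1 * e); first by rewrite mulr_gt0// invr_gt0.
move=> k s t st _ std; rewrite ltr_pdivlMl// in std.
apply: le_lt_trans std; rewrite mulr_sumr; apply: ler_sum => i _.
by have [? [? _]] := st i; exact: xK.
Qed.

(** The least element of the compact set of times in [[0, T]] with [h <= 0]. *)
Lemma first_zero (R : realType) (h : R -> R) (T : R) :
  continuous h -> 0 <= T -> 0 < h 0 -> h T <= 0 ->
  exists t, [/\ 0 <= t, h t = 0 & forall s, 0 <= s < t -> 0 < h s].
Proof.
move=> ch T0 h0 hT.
pose A := `[0, T] `&` [set t | h t <= 0].
have cA : compact A.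
  apply: (subclosed_compact _ (@segment_compact _ 0 T)); last by move=> t [].
  apply: closedI; first exact: itv_closed.
  apply: (@closed_comp _ _ h [set y | y <= 0]) => //.
have A0 : A !=set0 by exists T; split => //=; rewrite in_itv/= T0 lexx.
have cid : {within A, continuous (@id R)}.
  by apply: continuous_subspaceT => t; exact: cvg_id.
have [t + tmin] := compact_EVT_min A0 cA cid.
rewrite inE => -[/=]; rewrite in_itv/= => /andP[t0 tT] ht.
have pos s : 0 <= s < t -> 0 < h s.
  move=> /andP[s0 st]; rewrite ltNge; apply/negP => hs.
  have /tmin : s \in A.
    rewrite inE; split => //=; rewrite in_itv/= s0.
    exact: ltW (lt_le_trans st tT).
  by rewrite leNgt st.
exists t; split => //; apply/eqP; rewrite eq_le ht /=.
rewrite leNgt; apply/negP => ht0.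
(* A negative value at [t] would force a zero strictly before [t], against minimality. *)
have [||c] := @IVT _ h 0 t 0 t0; first exact: continuous_subspaceT.
  by rewrite ge_min le_max ht orbT ltW.
rewrite in_itv/= => /andP[c0]; rewrite le_eqVlt => /predU1P[->|ct] hc.
  by rewrite hc ltxx in ht0.
by have := pos c; rewrite c0 ct hc ltxx => /(_ isT).
Qed.

(** * Behaviour of [v] along the closed-loop trajectory *)

Theorem lemma3 (R : realType) (n m : nat)
  (f : 'cV[pol R n]_n) (G : 'M[pol R n]_(n, m))
  (gX gT : pol R n) (ubar : R) (u : 'cV[pol R n]_m)
  (compact_Xbar : compact (nneg_set gX))
  (ubar_ge0 : 0 <= ubar)
  (XT_sub_X : pos_set gT `<=` pos_set gX)
  (u_in_U : forall x, nneg_set gX x -> input_box ubar (mxeval u x))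
  (beta : R) (beta_gt0 : 0 < beta)
  (v w : 'cV[R]_n -> R)
  (v_C1 : C1_up_to (nneg_set gX) v)
  (w_C : {within nneg_set gX, continuous w})
  (v_flow : forall x, target_compl gX gT x ->
     dot (grad v x) (closed_loop f G u x) <= beta * v x)
  (w_ge_v1 : forall x, target_compl gX gT x -> v x + 1 <= w x)
  (w_ge0 : forall x, target_compl gX gT x -> 0 <= w x)
  (v_bd : forall x, zero_set gX x -> 0 <= v x) :
  [set x | pos_set gX x /\ v x < 0] `<=`
  region_of_attraction f G (pos_set gX) (input_box ubar) (pos_set gT).
Proof.
have [r r0 Xr] : exists2 r : R, 0 < r & forall x, nneg_set gX x -> `|x| <= r.
  have [r r0 Xr] := ex_strict_bound_gt0 (compact_bounded compact_Xbar).
  by exists r => // x /Xr/ltW.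
have clampE x : nneg_set gX x -> clamp r x = x.
  by move=> /Xr; exact: clamp_id.
have [K FK] := clamp_polynomial_bounded_lipschitz (ltW r0)
  (polynomial_closed_loop f G u).
have K0 : 0 <= K by have [+ _] := FK 0 0; exact: le_trans.
have L0 : 0 < K + 1 by lra.
have F_lip x y : `|(closed_loop f G u \o clamp r) x -
    (closed_loop f G u \o clamp r) y| <= (K + 1) * `|x - y|.
  have [_ /le_trans] := FK x y; apply; rewrite ler_wpM2r//; lra.
move=> x0 [/= x0X vx0].
have [x x_init xE] := lipschitz_ode_solution L0 (fun x => (FK x x).1) F_lip x0.
have x_lip (s t : R) : 0 <= s -> s <= t -> `|x t - x s| <= (K + 1) * (t - s).
  move=> s0 st; have ge0 (r' : R) : s <= r' <= t -> 0 <= r'.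
    by move=> /andP[+ _]; exact: le_trans.
  have le (r' : R) : s <= r' <= t ->
      `|(closed_loop f G u \o clamp r) (x r')| <= K + 1.
    by move=> _; have [+ _] := FK (x r') 0; lra.
  have := cV_increment_le st (fun r' h => xE r' (ge0 r' h))
    (fun r' _ => is_derive_mulrl (K + 1) r') le.
  by rewrite -mulrBr.
have xE' t : 0 <= t -> pos_set gX (x t) ->
    is_derive t 1 x (closed_loop f G u (x t)).
  by move=> t0 /ltW xt; have := xE t t0; rewrite /= clampE.
(* Freezing the time at 0 gives a function continuous on the whole line that agrees with [x] for
   [t >= 0]. *)
pose xp (t : R) := x (Num.max t 0).
have cxp : continuous xp.
  move=> t; apply: (@continuous_comp _ _ _ (fun t : R => Num.max t 0) x).
    by apply: (@continuous_max _ _ id (cst 0)); [exact: cvg_id|exact: cvg_cst].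
  have pos_ge0 : 0 <= Num.max t 0 by rewrite le_max lexx orbT.
  have [+ _] := xE _ pos_ge0.
  by move=> /derivable1_diffP; exact: differentiable_continuous.
have xpE t : 0 <= t -> xp t = x t by move=> t0; rewrite /xp max_l.
have cpeval (p : pol R n) : continuous (fun t => peval (xp t) p).
  move=> t; apply: (@continuous_comp _ _ _ xp (fun y => peval y p)).
    exact: cxp.
  exact: (polynomial_continuous (polynomial_peval p)).
apply: contrapT => notroa.
(* Otherwise the trajectory up to [tau], with the feedback as open-loop input, would witness that
   [x0] lies in the region of attraction. *)
have noT tau : 0 <= tau -> (forall t, 0 <= t <= tau -> pos_set gX (x t)) ->
    peval (x tau) gT <= 0.
  move=> tau0 xX; rewrite leNgt; apply/negP => xT; apply: notroa.
  exists tau, (fun t => mxeval u (x t)), x; split => //.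
  split.
    move=> j; apply: (@continuous_lebesgue_measurable _ _ _ _ (cpeval (u j 0))).
    by move=> t t0; rewrite mxE xpE.
  split; first by apply: (lipschitz_abs_continuous _ L0).
  split; first by apply: aeW => t /[dup] /xX xt /andP[t0 _]; exact: xE'.
  by split => // t /xX xt; split => //; apply: u_in_U; exact: ltW.
have [V [_ XV v_diff]] := v_C1.
(* At time [t] itself only membership in the closed set is assumed, so that the estimate applies at
   a first exit time. *)
have decay t : 0 <= t -> (forall s, 0 <= s < t -> pos_set gX (x s)) ->
    nneg_set gX (x t) -> v (x t) <= expR (beta * t) * v x0.
  move=> t0 xX xt.
  have xX' s : 0 <= s <= t -> nneg_set gX (x s).
    rewrite (le_eqVlt s) => /andP[s0 /predU1P[->//|st]].
    by apply/ltW/xX; rewrite s0.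
  (* With the integrating factor, the flow inequality says that [z] has a nonpositive derivative. *)
  pose z s := expR (- beta * s) * v (x s).
  have zE s : 0 <= s <= t -> is_derive s 1 z (expR (- beta * s) *
      (dot (grad v (x s)) (closed_loop f G u (x s)) - beta * v (x s))).
    move=> st; have xs := xX' s st; have [dv _] := v_diff _ (XV _ xs).
    have xsE : is_derive s 1 x (closed_loop f G u (x s)).
      by move: st => /andP[s0 _]; have := xE s s0; rewrite /= clampE.
    have := is_deriveM (is_derive_expRM (- beta) s) (is_derive_along dv xsE).
    rewrite /GRing.scale/= => H; apply: is_derive_eq H _; ring.
  have cE s : 0 <= s <= t -> is_derive s 1 (fun=> 0 : R) (0 : R).
    by move=> _; exact: is_derive_cst.
  have := is_derive_le_increment t0 zE cE.
  rewrite subrr /z x_init mulr0 expR0 mul1r subr_le0 => H.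
  have {}H : expR (- beta * t) * v (x t) <= v x0.
    apply: H => s /andP[s0 st].
    have xs : pos_set gX (x s) by apply: xX; rewrite ltW.
    rewrite mulr_ge0_le0 ?expR_ge0// subr_le0; apply: v_flow; split.
      exact: ltW.
    apply: noT => [|s']; first exact: ltW.
    by move=> /andP[s'0 s's]; apply: xX; rewrite s'0 (le_lt_trans s's).
  by move: H; rewrite mulNr expRN ler_pdivrMl// expR_gt0.
have stay t : 0 <= t -> pos_set gX (x t).
  move=> t0; rewrite /pos_set/= ltNge; apply/negP => xt.
  (* At the first zero [t1] of [gX] along the trajectory, [decay] makes [v] negative while the
     boundary condition makes it nonnegative. *)
  have [||t1 [t10 xt1 xX]] := first_zero (cpeval gX) t0.
  - by rewrite xpE// x_init.
  - by rewrite xpE.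
  rewrite xpE// in xt1.
  have xX' s : 0 <= s < t1 -> pos_set gX (x s).
    by move=> /[dup] /xX + /andP[s0 _]; rewrite xpE.
  have := decay t1 t10 xX'; rewrite /nneg_set/= xt1 lexx => /(_ isT).
  have := v_bd _ xt1; have := expR_gt0 (beta * t1); nra.
have cv : {within nneg_set gX, continuous v}.
  apply: continuous_in_subspaceT => y /[!inE] /XV /v_diff [dv _].
  exact: differentiable_continuous.
have [|c cX vc] := compact_EVT_min _ compact_Xbar cv.
  by exists x0; exact: ltW.
have vcx0 : v c <= v x0 by apply: vc; rewrite inE; exact: ltW.
(* Chosen so that [expR (beta * t) >= 1 + v c / v x0]. Multiplying by [v x0 < 0] bounds [v (x t)] by
   [v x0 + v c], which is below the minimum [v c]. *)
pose t := v c / v x0 / beta.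
have t0 : 0 <= t.
  rewrite /t divr_ge0 ?(ltW beta_gt0)// -mulrNN -invrN divr_ge0//; lra.
have xt : nneg_set gX (x t) by exact/ltW/stay.
have : v c <= expR (beta * t) * v x0.
  apply: le_trans (decay t t0 _ xt); first by apply: vc; rewrite inE.
  by move=> s /andP[s0 _]; exact: stay.
have : 1 + beta * t <= expR (beta * t) by exact: expR_ge1Dx.
have -> : beta * t = v c / v x0.
  by rewrite /t mulrC divfK// gt_eqF.
rewrite -(ler_nM2r vx0) mulrDl mul1r divfK ?lt_eqF//; lra.
Qed.
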